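(* Let $T$ be a tree of diameter $d$ and metric dimension $k$, where $k\geq 2$. Then \[ |V(T)| \leq \begin{cases} \frac{1}{8}(kd+4)(d+2) & \text{if } d \text{ is even},\\ \frac{1}{8}(kd-k+8)(d+1) & \text{if } d \text{ is odd}.\end{cases}\] Equality holds for even $d$ if and only if $T=HS_{d,k}$, and for odd $d$ if and only if $T=HS_{d,k,a}$ for some integer $a$ with $0<a<k$.
   Context: A set $R$ of vertices of a graph $G$ is a resolving set if for each pair $u,v$ of distinct vertices there is $x\in R$ with $d(x,u)\neq d(x,v)$; the metric dimension of $G$ is the smallest size of a resolving set. For $r\in\mathbb{N}$, let $L_r$ be the rooted tree obtained from a path $v_0,v_1,\ldots,v_r$ rooted at $v_0$ by attaching (at one of its end vertices) a path of length $r-i$ to vertex $v_i$ for $i=1,2,\ldots,r-1$. Let $P_r^*$ denote a path of length $r$ rooted at one of its end vertices. Let $k\geq 2$. For even $d$, the hairy spider $HS_{d,k}$ is the tree obtained from $k$ disjoint copies of $L_{d/2}$ and one path $P^*_{d/2}$ by identifying all their roots into a single vertex $v$. For odd $d\geq 3$ and an integer $a$ with $0\leq a\leq k$, $HS_{d,k,a}$ is the tree obtained from $k$ disjoint copies of $L_{(d-1)/2}$, two copies of $P^*_{(d-1)/2}$, and a path on two vertices $u,w$, by identifying the roots of $a$ copies of $L_{(d-1)/2}$ and of one copy of $P^*_{(d-1)/2}$ with $u$, and the roots of the remaining $k-a$ copies of $L_{(d-1)/2}$ and of the other copy of $P^*_{(d-1)/2}$ with $w$. *)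

(* Defs.v *)
From mathcomp Require Import all_boot.
Set Implicit Arguments. Unset Strict Implicit. Unset Printing Implicit Defensive.

Section Graphs.
Variable T : finType.
Variable e : rel T.

Definition simple_graph : Prop := symmetric e /\ irreflexive e.

Definition is_tree : Prop :=
  (forall x y : T, connect e x y) /\
  ~ (exists c : seq T, [&& uniq c, 2 < size c & cycle e c]).

Definition walk_n (x y : T) (n : nat) : bool :=
  [exists p : n.-tuple T, path e x p && (last x p == y)].

(* distance = least n such that a walk of length n from x to y exists
   (searched among 0..#|T|-1, which suffices in a connected graph) *)
Definition dist (x y : T) : nat := find (walk_n x y) (iota 0 #|T|).

Definition diameter : nat := \max_(x : T) \max_(y : T) dist x y.

Definition resolving (R : {set T}) : bool :=
  [forall u : T, forall v : T,
     (u != v) ==> [exists x in R, dist x u != dist x v]].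

Definition metric_dim (k : nat) : Prop :=
  (exists R : {set T}, resolving R /\ #|R| = k) /\
  (forall R : {set T}, resolving R -> k <= #|R|).
End Graphs.

Definition isomorphic (T T' : finType) (e : rel T) (e' : rel T') : Prop :=
  exists f : T -> T', bijective f /\ forall x y, e' (f x) (f y) = e x y.

(* a vertex is a seq nat; the parent of a nonempty address v is v minus its last entry *)
Definition addr_adj (u v : seq nat) : bool :=
  ((v != [::]) && (u == take (size v).-1 v)) ||
  ((u != [::]) && (v == take (size u).-1 u)).

Definition addr_vert (S : seq (seq nat)) : finType := seq_sub S.
Definition addr_graph (S : seq (seq nat)) : rel (addr_vert S) :=
  fun x y => addr_adj (val x) (val y).

(* Non-root vertices of L_r, addressed relative to v_1 (the unique child of the
   root v_0): v_{i+1} is nseq i 0 (0 <= i < r); the path of length r-(i+1)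
   attached at v_{i+1} contributes the r-(i+1) new vertices
   nseq i 0 ++ 1 :: nseq j 0, j < r-(i+1). *)
Definition branchL (r : nat) : seq (seq nat) :=
  [seq nseq i 0 | i <- iota 0 r] ++
  flatten [seq [seq nseq i 0 ++ 1 :: nseq j 0 | j <- iota 0 (r - i.+1)]
          | i <- iota 0 r].

(* Non-root vertices of P*_r (relative to the child of the root). *)
Definition branchP (r : nat) : seq (seq nat) := [seq nseq i 0 | i <- iota 0 r].

(* HS_{d,k} (d even): root v = [::]; copy c (c < k) of L_{d/2} hangs below child c,
   P*_{d/2} below child k. *)
Definition HS_even_addrs (d k : nat) : seq (seq nat) :=
  [::] :: [seq c :: b | c <- iota 0 k, b <- branchL d./2]
       ++ [seq k :: b | b <- branchP d./2].

(* HS_{d,k,a} (d odd): u = [::], w = [:: a.+1];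
   u carries a copies of L_{(d-1)/2} (children 0..a-1) and P* (child a);
   w carries k-a copies of L_{(d-1)/2} (children 0..k-a-1) and P* (child k-a). *)
Definition HS_odd_addrs (d k a : nat) : seq (seq nat) :=
  [::] :: [seq c :: b | c <- iota 0 a, b <- branchL d./2]
       ++ [seq a :: b | b <- branchP d./2]
       ++ [:: [:: a.+1]]
       ++ [seq [:: a.+1, c & b] | c <- iota 0 (k - a), b <- branchL d./2]
       ++ [seq [:: a.+1, k - a & b] | b <- branchP d./2].

Definition HS_even (d k : nat) := @addr_graph (HS_even_addrs d k).
Definition HS_odd (d k a : nat) := @addr_graph (HS_odd_addrs d k a).


(* sanity checks: vertex counts match the bounds (e.g. (kd+4)(d+2)/8) *)
Example HS_even_size : size (undup (HS_even_addrs 6 3)) = 22. Proof. by []. Qed.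
Example HS_odd_size : size (undup (HS_odd_addrs 5 3 1)) = 15. Proof. by []. Qed.
Arguments HS_even : clear implicits.
Arguments HS_odd : clear implicits.
Arguments addr_graph : clear implicits.

(* Main.v *)
Require Import Defs.
From mathcomp Require Import all_boot zify.
Set Implicit Arguments. Unset Strict Implicit. Unset Printing Implicit Defensive.

(* Let r be the integer part of d/2. Every vertex of T is within r of the core:
   the central vertex if d is even, the central edge if d is odd. Let R be a
   resolving set of size k and let the trunk be the union of the core and of the
   paths from the core to R. A component hanging off the trunk at y contains at
   most one vertex at each distance from y, since R cannot tell two of them
   apart, so a vertex is determined by its foot in the trunk and its depth.
   Outside the core the trunk has at most k vertices at each depth, which gives
   the bound. This injection of V(T) is taken with values in the addresses of
   the hairy spider: in the extremal case it is onto, which forces it to commute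
   with taking parents. *)

(** * Distance in a connected graph *)

Section Distance.
Variables (T : finType) (e : rel T).

Lemma dist_le x s : path e x s -> dist e x (last x s) <= size s.
Proof.
move=> es; rewrite leqNgt; apply/negP => lt_s.
(* [find] never exceeds the length of the list searched, so a walk shorter than the distance has
   fewer than [#|T|] edges. *)
have s_lt : size s < #|T|.
  by apply: leq_trans lt_s _; rewrite -[X in _ <= X](size_iota 0) find_size.
have /negP[] := negbT (before_find 0 lt_s).
by rewrite nth_iota //; apply/existsP; exists (in_tuple s); rewrite es eqxx.
Qed.

(** Shortening a walk to a simple path brings its length into the range searched by [dist], so the
    search succeeds. *)
Lemma dist_path x y : connect e x y ->
  exists2 s, path e x s & last x s = y /\ size s = dist e x y.
Proof.
case/connectP=> s0 /shortenP[s es us _] ->{s0 y}.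
have s_lt : size s < #|T| by rewrite -[_.+1]/(size (x :: s)) -(card_uniqP us) max_card.
have hw : has (walk_n e x (last x s)) (iota 0 #|T|).
  apply/hasP; exists (size s); first by rewrite mem_iota.
  by apply/existsP; exists (in_tuple s); rewrite es eqxx.
have := nth_find 0 hw; rewrite has_find size_iota in hw.
rewrite nth_iota // => /existsP[t /andP[et /eqP lt]].
by exists t => //; rewrite size_tuple.
Qed.

Lemma dist0 x : dist e x x = 0.
Proof. by have := @dist_le x [::] isT; rewrite leqn0 => /eqP. Qed.

Hypotheses (e_sym : symmetric e) (e_conn : forall x y, connect e x y).

Lemma dist_eq0 x y : dist e x y = 0 -> x = y.
Proof. by have [[|z s] _ [<- <-]] := dist_path (e_conn x y). Qed.

Lemma dist_triangle y x z : dist e x z <= dist e x y + dist e y z.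
Proof.
have [s es [<- <-]] := dist_path (e_conn x y).
have [t et [<- <-]] := dist_path (e_conn (last x s) z).
by rewrite -size_cat -last_cat; apply: dist_le; rewrite cat_path es.
Qed.

Lemma dist_edge x y : e x y -> dist e x y <= 1.
Proof. by move=> exy; apply: (@dist_le x [:: y]); rewrite /= exy. Qed.

Lemma dist_sym x y : dist e x y = dist e y x.
Proof.
suff le_d a b : dist e a b <= dist e b a by apply/eqP; rewrite eqn_leq !le_d.
have [s es [<- <-]] := dist_path (e_conn b a).
have := @dist_le (last b s) (rev (belast b s)).
rewrite size_rev size_belast rev_path.
have -> : last (last b s) (rev (belast b s)) = b.
  by case: (s) => //= c t; rewrite rev_cons last_rcons.
by apply; under eq_path do rewrite e_sym.
Qed.

Lemma geodesic_point x y n : n <= dist e x y ->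
  exists2 z, dist e x z = n & dist e z y = dist e x y - n.
Proof.
have [s es [ls sz]] := dist_path (e_conn x y); rewrite -sz => le_n.
move: es ls; rewrite -{1 2}(cat_take_drop n s) cat_path last_cat.
set z := last x _ => /andP[es1 es2] ls; exists z.
  have := dist_le es1; have := dist_le es2; rewrite ls -/z size_drop size_take_min.
  by have := dist_triangle z x y; lia.
have := dist_le es1; have := dist_le es2; rewrite ls -/z size_drop size_take_min.
by have := dist_triangle z x y; lia.
Qed.

End Distance.

(** * Rooted trees *)

Section Rooted.
Variables (T : finType) (e : rel T).
Hypotheses (e_sym : symmetric e) (e_irr : irreflexive e) (e_tree : is_tree e).
Variable u : T.
Let e_conn : forall x y, connect e x y := proj1 e_tree.

Definition height x := dist e u x.
Local Notation h := height.
(** The default value makes the root its own parent, so [fconnect p x y] says that [y] lies on the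
    path from [x] to the root, ends included. *)
Definition parent x := odflt x [pick y | e x y && (h y < h x)].
Local Notation p := parent.

Lemma height_root x : (h x == 0) = (x == u).
Proof.
apply/eqP/eqP => [/(dist_eq0 e_conn)-> //|->]; exact: dist0.
Qed.

Lemma height_edge x y : e x y -> h y <= (h x).+1.
Proof.
by move=> /dist_edge; have := dist_triangle e_conn x u y; rewrite /h; lia.
Qed.

Lemma lower_neighbor x : x != u -> exists2 y, e x y & h x = (h y).+1.
Proof.
have [s es [ls sz]] := dist_path (e_conn u x).
case/lastP: s es ls sz => [|s y]; first by move=> _ /= -> _ /eqP.
rewrite rcons_path last_rcons size_rcons => /andP[es ey] <-{x} sz _.
exists (last u s); first by rewrite e_sym.
by have := dist_le es; have := height_edge ey; rewrite /h; lia.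
Qed.

(* Both neighbors reach the root through vertices of height at most that of x
   other than x, so two of them would close a cycle through x. *)
Lemma low_neighbor_uniq x y y' :
  e x y -> e x y' -> h y <= h x -> h y' <= h x -> y = y'.
Proof.
move=> exy exy' hy hy'; apply/eqP/negP => /negP ney.
pose e' := [rel a b | [&& e a b, a != x & b != x]].
have xne b : e x b -> b != x by apply: contraTneq => ->; rewrite e_irr.
have toroot n z : h z = n -> z != x -> n <= h x -> connect e' z u.
  elim: n z => [|n IHn] z hz zx nx.
    by move/eqP: hz; rewrite height_root => /eqP->; apply: connect0.
  have /lower_neighbor[z' ezz' hz'] : z != u by rewrite -height_root hz.
  have z'x : z' != x by apply/eqP => z'x; move: nx; rewrite -z'x; lia.
  apply: connect_trans (connect1 _) (IHn z' _ z'x _); try lia.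
  by rewrite /= ezz' zx z'x.
have e'_sym : connect_sym e'.
  by apply: sym_connect_sym => a b; rewrite /= e_sym [(a != x) && _]andbC.
have := connect_trans (toroot _ y erefl (xne _ exy) hy) _.
move=> /(_ y'); rewrite e'_sym => /(_ (toroot _ y' erefl (xne _ exy') hy')).
case/connectP=> s0 /shortenP[s es us _] ly.
case: e_tree => _ [].
exists (x :: y :: s).
have xs : x \notin s.
  elim: s y es {us ly exy hy ney} => //= z s IHs y /andP[/and3P[_ _ zx] es].
  by rewrite inE negb_or eq_sym zx (IHs z).
have es1 : path e y s by apply: sub_path es => a b /and3P[].
case: s us ly xs es1 {es} => [|z s] us ly xs es1; first by rewrite ly eqxx in ney.
have ec : cycle e [:: x, y, z & s].
  by rewrite (cycle_path x) /= -[last z s]/(last y (z :: s)) -ly e_sym exy' exy.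
by rewrite ec cons_uniq us inE negb_or eq_sym (xne _ exy) xs.
Qed.

Lemma parentP x : x != u -> e x (p x) /\ h x = (h (p x)).+1.
Proof.
move=> xu; have [y exy hy] := lower_neighbor xu.
rewrite /p; case: pickP => [z /= /andP[exz hz]|/(_ y)]; last by rewrite exy hy ltnSn.
have zy : z = y by apply: (low_neighbor_uniq exz exy); lia.
by rewrite zy.
Qed.

Lemma parent_root : p u = u.
Proof.
rewrite /p; case: pickP => //= y /andP[_].
by have /eqP -> : h u == 0 by rewrite height_root.
Qed.

Lemma height_parent x : h (p x) = (h x).-1.
Proof.
have [->|/parentP[_ ->] //] := eqVneq x u.
by rewrite parent_root; have /eqP -> : h u == 0 by rewrite height_root.
Qed.

(** [low_neighbor_uniq] also covers neighbors of equal height, so the end of an edge that is not the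
    higher one must be the parent of the other. *)
Lemma edge_parent x y :
  e x y = (x != u) && (p x == y) || (y != u) && (p y == x).
Proof.
apply/idP/orP => [exy|[]/andP[/parentP[ex _] /eqP<- //]]; last by rewrite e_sym.
wlog hyx : x y exy / h y <= h x.
  move=> W; case: (leqP (h y) (h x)) => [/W|/ltnW /W]; first exact.
  by rewrite e_sym => /(_ exy) [] ->; [right | left].
have [xu|xu] := eqVneq x u.
  have : h y = 0 by apply/eqP; rewrite -leqn0 (leq_trans hyx) // xu leqn0 height_root.
  by move/eqP; rewrite height_root => /eqP yu; rewrite xu yu e_irr in exy.
have [exp hp] := parentP xu; left => /=.
by rewrite (low_neighbor_uniq exp exy) // hp.
Qed.

Lemma height_iter n x : h (iter n p x) = h x - n.
Proof. by elim: n => [|n IHn]; rewrite ?subn0 // iterS height_parent IHn subnS. Qed.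

Lemma ancestor_height x y : fconnect p x y -> h y <= h x.
Proof. by move/iter_findex <-; rewrite height_iter leq_subr. Qed.

(** Heights drop by one at each step until the root, so the height tells which iterate of [p] is
    meant. *)
Lemma ancestor_inj x y y' :
  fconnect p x y -> fconnect p x y' -> h y = h y' -> y = y'.
Proof.
move=> /iter_findex <- /iter_findex <-; set n := findex _ _ _; set n' := findex _ _ _.
rewrite !height_iter => eq_h.
have [lt|] := ltnP n (h x); first by have -> : n = n' by lia.
move=> le; have Hr m : h x <= m -> iter m p x = u.
  by move=> lem; apply/eqP; rewrite -height_root height_iter; lia.
by rewrite !Hr //; lia.
Qed.

Lemma ancestor_parent x y : fconnect p x y -> x = y \/ fconnect p (p x) y.
Proof.
move/iter_findex <-; case: (findex _ _ _) => [|n]; first by left.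
by right; rewrite iterSr fconnect_iter.
Qed.

(** The edge from [c] to its parent is the only one leaving the subtree below [c], so a shortest
    path from [x] to [z] crosses it. *)
Lemma cut_dist c x z : c != u -> ~~ fconnect p x c -> fconnect p z c ->
  dist e x (p c) + (dist e c z).+1 <= dist e x z.
Proof.
move=> cu; have [s es [<- <-]] := dist_path (e_conn x z).
elim: s x es => [|y s IHs] x /=; first by move=> _ /negPf->.
case/andP=> exy es xc zc; have [yc|yc] := boolP (fconnect p y c); last first.
  have := IHs y es yc zc; have := dist_triangle e_conn y x (p c).
  by have := dist_edge exy; lia.
(* The path enters the subtree here, so [y] is [c] and [x] is its parent. *)
move: exy; rewrite edge_parent => /orP[]/andP[xu /eqP Dy].
  by rewrite -Dy in yc; rewrite (connect_trans (fconnect1 p x) yc) in xc.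
case: (ancestor_parent yc) => [yc'|]; last by rewrite Dy (negPf xc).
by rewrite -yc' Dy dist0; have := dist_le es; lia.
Qed.

Lemma dist_parent x z : z != u -> ~~ fconnect p x z ->
  dist e x z = (dist e x (p z)).+1.
Proof.
move=> zu xz; have := cut_dist zu xz (connect0 _ z); rewrite dist0.
have [ez _] := parentP zu; rewrite e_sym in ez.
by have := dist_edge ez; have := dist_triangle e_conn (p z) x z; lia.
Qed.

End Rooted.

(** * Addresses and vertex counts of hairy spiders *)

(* The address, relative to v_1, of the vertex at distance m from v_(n+1) on
   the path attached there in some L_r. *)
Definition hair n m : seq nat :=
  nseq n 0 ++ (if m is m'.+1 then 1 :: nseq m' 0 else [::]).

Lemma size_hair n m : size (hair n m) = n + m.
Proof. by case: m => [|m]; rewrite size_cat size_nseq //= size_nseq. Qed.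

(** The entry 1 marks where the attached path leaves the spine; if [m] is 0 there is none, and
    [index] returns the length, again [n]. *)
Lemma index_hair n m : index 1 (hair n m) = n.
Proof.
rewrite index_cat size_nseq mem_nseq andbF.
by case: m => [|m] /=; rewrite addn0.
Qed.

Lemma hair_inj n m n' m' : hair n m = hair n' m' -> n = n' /\ m = m'.
Proof.
move=> eq_h; have := congr1 (index 1) eq_h; have := congr1 size eq_h.
by rewrite !size_hair !index_hair; lia.
Qed.

Lemma take_hair n m : take (n + m) (hair n m.+1) = hair n m.
Proof.
rewrite /hair take_cat size_nseq ltnNge leq_addr /= addKn; congr (_ ++ _).
case: m => //= m; congr (1 :: _).
exact: (take_nseq _ (leqnSn m)).
Qed.

Lemma take_hair0 n : take n (hair n.+1 0) = hair n 0.
Proof. by rewrite /hair !cats0 take_nseq. Qed.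

Lemma mem_branchL r n m : n + m < r -> hair n m \in branchL r.
Proof.
move=> lt; rewrite mem_cat; case: m lt => [|m] lt.
  by rewrite /hair cats0 (map_f (nseq^~ 0)) // mem_iota; lia.
apply/orP; right; apply/allpairsPdep; exists n, m.
by rewrite !mem_iota; split => //; lia.
Qed.

Lemma size_branchL r : 2 * size (branchL r) = r * r.+1.
Proof.
rewrite size_cat size_map size_iota size_allpairs_dep.
under eq_map do rewrite size_iota.
suff : 2 * sumn [seq r - i.+1 | i <- iota 0 r] = r * r.-1 by case: r => //=; lia.
elim: r => // r IHr; rewrite /= (iotaDl 1 0) -map_comp.
under eq_map do rewrite /= add1n subSS.
by rewrite mulnDr IHr; case: (r); lia.
Qed.

Lemma uniq_branchL r : uniq (branchL r).
Proof.
have nseq_inj : injective (fun i => nseq i 0).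
  by move=> i j /(congr1 size); rewrite !size_nseq.
rewrite cat_uniq map_inj_uniq // iota_uniq /=; apply/andP; split.
  apply/hasPn => t /allpairsPdep[i [j [_ _ ->]]]; apply/negP => /mapP[l _ eq_t].
  have : 1 \in nseq l 0 by rewrite -eq_t mem_cat mem_head orbT.
  by rewrite mem_nseq andbF.
apply: (@allpairs_uniq_dep _ _ _ (fun i j => hair i j.+1)); first exact: iota_uniq.
  by move=> *; apply: iota_uniq.
by move=> [i j] [i' j'] _ _ /= /hair_inj[-> [->]].
Qed.

(** The even hairy spider of radius [r]; the odd one has such a tree at each end of its central
    edge. *)
Definition spider r n : seq (seq nat) :=
  [::] :: [seq c :: b | c <- iota 0 n, b <- branchL r]
       ++ [seq n :: b | b <- branchP r].

Lemma mem_spider_hair r n c i m :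
  c < n -> i + m < r -> c :: hair i m \in spider r n.
Proof.
move=> cn im; rewrite inE mem_cat; apply/orP; right; apply/orP; left.
by apply/allpairsP; exists (c, hair i m); rewrite mem_iota mem_branchL.
Qed.

Lemma mem_spider_path r n i : i < r -> n :: hair i 0 \in spider r n.
Proof.
move=> ir; rewrite inE mem_cat; apply/orP; right; apply/orP; right.
by rewrite map_f // /hair cats0 (map_f (nseq^~ 0)) // mem_iota.
Qed.

(** Keeps the two parts of [dispider] apart: the second part uses a first entry that does not occur
    in the first part. *)
Lemma head_spider r n t : t \in spider r n -> head 0 t <= n.
Proof.
rewrite inE mem_cat => /or3P[/eqP-> //|/allpairsP[[c b] [/= + _ ->]]|/mapP[b _ ->]//].
by rewrite mem_iota /= add0n => /ltnW.
Qed.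

Lemma uniq_spider r n : uniq (spider r n).
Proof.
have cons_inj c : injective (fun b : seq nat => c :: b) by move=> b b' [].
rewrite /= cat_uniq mem_cat; apply/and3P; split=> [|| ].
- by apply/norP; split; apply/negP; [case/allpairsP=> -[c b] [_ _] | case/mapP].
- apply: allpairs_uniq; [exact: iota_uniq|exact: uniq_branchL|].
  by move=> [c b] [c' b'] _ _ [-> ->].
apply/andP; split.
  apply/hasPn => _ /mapP[b _ ->]; apply/negP => /allpairsP[[c b'] [/= cn _ [nc _]]].
  by rewrite mem_iota /= -nc add0n ltnn in cn.
rewrite !map_inj_uniq ?iota_uniq // => i j /(congr1 size).
by rewrite !size_nseq.
Qed.

Lemma size_spider r n : 2 * size (spider r n) = (n * r + 2) * r.+1.
Proof.
rewrite /= size_cat size_allpairs !size_map !size_iota.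
by have := size_branchL r; nia.
Qed.

Definition dispider r m n : seq (seq nat) :=
  spider r m ++ map (cons m.+1) (spider r n).

Lemma uniq_dispider r m n : uniq (dispider r m n).
Proof.
rewrite cat_uniq uniq_spider map_inj_uniq ?uniq_spider ?andbT; last by move=> ? ? [].
apply/hasPn => _ /mapP[t _ ->]; apply/negP => /head_spider /=.
by rewrite ltnn.
Qed.

Lemma size_dispider r m n :
  2 * size (dispider r m n) = ((m + n) * r + 4) * r.+1.
Proof. by rewrite size_cat size_map mulnDr !size_spider; nia. Qed.

(** The bound of the theorem, cleared of its denominator, at [d = 2 * r]; the next lemma does the
    same at [d = (2 * r).+1]. *)
Lemma size_spider_even r k :
  8 * size (spider r k) = (k * (2 * r) + 4) * (2 * r + 2).
Proof. by have := size_spider r k; nia. Qed.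

Lemma size_dispider_odd r m n :
  8 * size (dispider r m n) =
  ((m + n) * (2 * r).+1 - (m + n) + 8) * ((2 * r).+1 + 1).
Proof. by rewrite mulnS addKn; have := size_dispider r m n; nia. Qed.

Lemma HS_even_addrsE d k : HS_even_addrs d k = spider d./2 k.
Proof. by []. Qed.

Lemma HS_odd_addrsE d k a :
  HS_odd_addrs d k a = dispider d./2 a (k - a).
Proof.
rewrite /HS_odd_addrs /dispider /spider /= -catA map_cat map_allpairs -map_comp.
by [].
Qed.

(** * The center of a tree *)

Lemma dist_le_diameter (T : finType) (e : rel T) x y : dist e x y <= diameter e.
Proof.
apply: (leq_trans (@leq_bigmax _ (fun y => dist e x y) y)).
exact: (@leq_bigmax _ (fun x => \max_(y : T) dist e x y) x).
Qed.

(** Take [u] and [w] consecutive in the middle of a longest path from [a] to [b]. The path from [z]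
    to the one of [a], [b] across the edge [uw] is no longer than the diameter, which bounds the
    distance from [z] to [u]. *)
Lemma tree_center (T : finType) (e : rel T) : symmetric e -> irreflexive e ->
  is_tree e -> 0 < diameter e ->
  exists u w, dist e u w = 1 /\ forall z, dist e u z <=
    if fconnect (parent e u) z w then diameter e - (diameter e)./2
    else (diameter e)./2.
Proof.
move=> e_sym e_irr e_tree; have e_conn := proj1 e_tree; have le_diam := dist_le_diameter e.
set d := diameter e in le_diam * => d_gt0.
have [a [b dab]] : exists a b, dist e a b = d.
  have T_gt0 : 0 < #|T|.
    rewrite lt0n; apply/eqP => /card0_eq T0.
    by move: d_gt0; rewrite /d /diameter big_pred0.
  have [a Da] := eq_bigmax (fun x => \max_(y : T) dist e x y) T_gt0.
  have [b Db] := eq_bigmax (fun y => dist e a y) T_gt0.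
  by exists a, b; rewrite /d /diameter Da Db.
have [|u dau dub] := @geodesic_point _ _ e_conn a b d./2; first lia.
have [|w duw dwb] := @geodesic_point _ _ e_conn u b 1; first lia.
exists u, w; split=> // z.
have wu : w != u by apply/eqP => wu; rewrite wu dist0 in duw.
have pw : parent e u w = u.
  have [_] := parentP e_sym e_irr e_tree wu; rewrite /height duw => -[] h0.
  by apply/eqP; rewrite -(height_root e_tree) /height -h0.
have cut x y : ~~ fconnect (parent e u) x w -> fconnect (parent e u) y w ->
    dist e x u + (dist e w y).+1 <= dist e x y.
  by move=> xw yw; have := cut_dist e_sym e_irr e_tree wu xw yw; rewrite pw.
have dC := dist_sym e_sym e_conn.
(* The edge [uw] separates the ends: [b] is below [w] and [a] is not. *)
have bw : fconnect (parent e u) b w.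
  apply: contraT => bw; have := cut b w bw (connect0 _ _).
  by rewrite dist0 dC (dC b w); lia.
have aw : ~~ fconnect (parent e u) a w.
  apply/negP => aw; have u0 : ~~ fconnect (parent e u) u w.
    by apply/negP => /(ancestor_height e_sym e_irr e_tree); rewrite /height dist0 duw.
  have := cut u a u0 aw; rewrite dist0 (dC u a).
  by have := dist_triangle e_conn w a b; rewrite (dC a w); lia.
case: ifP => [zw|/negbT zw].
  have := cut a z aw zw; have := dist_triangle e_conn w u z.
  by have := le_diam a z; lia.
have := cut z b zw bw; have := le_diam z b.
by rewrite (dC z u); lia.
Qed.

(** * Trunk, feet and addresses of vertices *)

Section Addressing.
Variables (T : finType) (e : rel T).
Hypotheses (e_sym : symmetric e) (e_irr : irreflexive e) (e_tree : is_tree e).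
Variables (u w : T) (o : bool) (r : nat) (R : {set T}).
Local Notation p := (parent e u).
Local Notation h := (height e u).
Let anc_h := ancestor_height e_sym e_irr e_tree.

(* For o = false the core of the tree is the root u alone, and for o = true it
   is the edge uw; [depth] is the distance to the core. *)
Definition side z := o && fconnect p z w.
Definition depth z := h z - side z.
Definition core b := if b then w else u.

Hypotheses (hw : h w = 1) (depth_le : forall z, depth z <= r).
Hypothesis R_res : resolving e R.

(** The truncated subtraction in [depth] loses nothing, since the descendants of [w] have height at
    least 1. *)
Lemma height_depth z : h z = depth z + side z.
Proof.
rewrite /depth /side; case: o => //=; last by rewrite subn0 addn0.
by have [/anc_h|_] := boolP (fconnect _ _ _); rewrite ?hw /=; lia.
Qed.

Lemma depth_core z : depth z = 0 -> z = core (side z).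
Proof.
move=> z0; have := height_depth z; rewrite z0 add0n /core.
case: ifP => [/andP[_ zw] hz|_ hz].
  by apply: (ancestor_inj e_sym e_irr e_tree (connect0 _ z) zw); rewrite hz hw.
by apply/eqP; rewrite -(height_root e_tree) hz.
Qed.

Lemma side_u : side u = false.
Proof.
apply/negbTE/negP => /andP[_ /anc_h].
by rewrite hw /height dist0.
Qed.

Lemma depth_u : depth u = 0.
Proof. by rewrite /depth /height dist0. Qed.

Lemma depth_gt0_neq z : 0 < depth z -> z != u.
Proof. by apply: contraTneq => ->; rewrite depth_u. Qed.

(** Only the core edge joins the two sides, and its ends have depth 0. *)
Lemma side_parent z : 0 < depth z -> side (p z) = side z.
Proof.
move=> z_gt0; have := height_depth z; rewrite /side; case: (o) => //= hz.
apply/idP/idP => [|zw]; first exact: connect_trans (fconnect1 _ _).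
rewrite zw in hz; case: (ancestor_parent zw) => // Dz.
by move: hz; rewrite Dz hw; rewrite Dz in z_gt0; lia.
Qed.

Lemma depth_parent z : depth (p z) = (depth z).-1.
Proof.
have [z0|z_gt0] := posnP (depth z); last first.
  by rewrite /depth side_parent // (height_parent e_sym e_irr e_tree); lia.
have := depth_core z0; rewrite z0 /=; case: (side z) => /= ->; last first.
  by rewrite (parent_root e_tree) depth_u.
by rewrite /depth (height_parent e_sym e_irr e_tree) hw.
Qed.

Lemma ancestor_side z y : fconnect p z y -> 0 < depth y -> side y = side z.
Proof.
move/iter_findex <-; elim: (findex _ _ _) => //= n IHn.
rewrite depth_parent => y_gt0; have lt0 : 0 < depth (iter n p z) by lia.
by rewrite side_parent // IHn.
Qed.

(* The core together with all vertices on paths from the core to R. *)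
Definition trunk := [pred y | (depth y == 0) || [exists x in R, fconnect p x y]].

(** [n] is fuel: the root lies in the trunk, so [h z] steps always reach the trunk. *)
Fixpoint climb n z :=
  if n is n'.+1 then if z \in trunk then z else climb n' (p z) else z.
Definition foot z := climb (h z) z.

Lemma footE z : foot z = if z \in trunk then z else foot (p z).
Proof.
rewrite /foot (height_parent e_sym e_irr e_tree).
case hz: (h z) => [|n] //=.
by rewrite inE /depth hz.
Qed.

Lemma notin_trunk z : z \notin trunk ->
  0 < depth z /\ forall x, x \in R -> ~~ fconnect p x z.
Proof.
rewrite inE negb_or -lt0n negb_exists_in => /andP[-> /forall_inP zR].
by split.
Qed.

Lemma foot_ind (P : T -> Prop) : (forall z, z \in trunk -> P z) ->
  (forall z, z \notin trunk -> P (p z) -> P z) -> forall z, P z.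
Proof.
move=> P1 P2 z; elim: {z}(h z).+1 {-2}z (leqnn (h z).+1) => // n IHn z hz.
have [/P1 //|zA] := boolP (z \in trunk); apply: (P2) => //; apply: IHn.
have [z_gt0 _] := notin_trunk zA; rewrite (height_parent e_sym e_irr e_tree).
by have := height_depth z; lia.
Qed.

Lemma foot_trunk z : foot z \in trunk.
Proof.
elim/foot_ind: z => z zA; first by rewrite footE zA.
by rewrite [foot z]footE (negPf zA).
Qed.

Lemma foot_id z : z \in trunk -> foot z = z.
Proof. by move=> zA; rewrite footE zA. Qed.

Lemma foot_parent z : z \notin trunk -> foot z = foot (p z).
Proof. by move=> zA; rewrite footE (negPf zA). Qed.

Lemma foot_depth z : depth (foot z) <= depth z.
Proof.
elim/foot_ind: z => z zA; first by rewrite foot_id.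
by rewrite (foot_parent zA) depth_parent; lia.
Qed.

Lemma foot_side z : side (foot z) = side z.
Proof.
elim/foot_ind: z => z zA; first by rewrite foot_id.
by rewrite (foot_parent zA) => ->; rewrite side_parent //; case: (notin_trunk zA).
Qed.

(** No landmark lies below a vertex outside the trunk, so by [dist_parent] each step from the foot
    out to [z] adds one to the distance. *)
Lemma dist_foot x z : x \in R ->
  dist e x z = dist e x (foot z) + (depth z - depth (foot z)).
Proof.
move=> xR; elim/foot_ind: z => z zA; first by rewrite foot_id // subnn addn0.
have [z_gt0 /(_ x xR) xz] := notin_trunk zA.
rewrite (dist_parent e_sym e_irr e_tree (depth_gt0_neq z_gt0)) // => ->.
by rewrite (foot_parent zA); have := foot_depth (p z); rewrite depth_parent; lia.
Qed.

Lemma resolving_eq z z' :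
  (forall x, x \in R -> dist e x z = dist e x z') -> z = z'.
Proof.
move=> eq_d; apply/eqP/negPn/negP => zz'.
have /forallP/(_ z)/forallP/(_ z')/implyP/(_ zz') := R_res.
by case/exists_inP => x xR; rewrite eq_d // eqxx.
Qed.

(** By [dist_foot] the two vertices have the same distance from every landmark. *)
Lemma foot_inj z z' : foot z = foot z' -> depth z = depth z' -> z = z'.
Proof.
by move=> eq_f eq_d; apply: resolving_eq => x xR; rewrite (dist_foot z) // (dist_foot z') // eq_f eq_d.
Qed.

Definition landmarks b := enum [set x in R | side x == b].
Definition nb b := size (landmarks b).

Lemma nb_sum : nb false + nb true = #|R|.
Proof.
rewrite /nb /landmarks -!cardE -(cardsID [set x | side x] R) addnC.
by congr (_ + _); apply: eq_card => x; rewrite !inE; case: (side x); rewrite ?andbT ?andbF.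
Qed.

(* The leg below which z sits; [find] returns the index [nb (side z)] of the
   landmark-free path exactly when the foot of z is in the core. *)
Definition leg z :=
  find (fun x => (0 < depth (foot z)) && fconnect p x (foot z)) (landmarks (side z)).
(** The depth at which the attached path of [z] leaves the spine. A vertex with its foot in the core
    lies on the landmark-free path, which is all spine, so its own depth is taken. *)
Definition level z := if depth (foot z) == 0 then depth z else depth (foot z).
(** [hair] is relative to v_1, hence the predecessor of the level. *)
Definition loc z :=
  if depth z == 0 then [::] else leg z :: hair (level z).-1 (depth z - level z).

Lemma leg_lt z : 0 < depth (foot z) -> leg z < nb (side z).
Proof.
move=> f_gt0; rewrite -has_find; have := foot_trunk z.
rewrite inE eqn0Ngt f_gt0 => /exists_inP[x xR xz]; apply/hasP; exists x; last by apply/andP.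
by rewrite mem_enum inE xR -(ancestor_side xz) // foot_side eqxx.
Qed.

Lemma leg_core z : depth (foot z) = 0 -> leg z = nb (side z).
Proof. by move=> f0; apply/hasNfind/hasPn => x _; rewrite f0. Qed.

Lemma leg_ancestor z : 0 < depth (foot z) ->
  fconnect p (nth u (landmarks (side z)) (leg z)) (foot z).
Proof.
by move/leg_lt; rewrite -has_find => /(nth_find u) /andP[].
Qed.

Lemma level_gt0 z : 0 < depth z -> 0 < level z.
Proof. by rewrite /level; case: ifP => //; case: depth. Qed.

Lemma level_le z : level z <= depth z.
Proof. by rewrite /level; case: ifP => // _; apply: foot_depth. Qed.

Lemma loc_spider z : loc z \in spider r (nb (side z)).
Proof.
rewrite /loc; case: eqP => [_|/eqP]; first exact: mem_head.
rewrite -lt0n => z_gt0; have lv_gt0 := level_gt0 z_gt0.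
have lv_le := level_le z; have z_r := depth_le z.
have [f0|f_gt0] := posnP (depth (foot z)).
  have -> : depth z - level z = 0 by rewrite /level f0 eqxx subnn.
  by rewrite leg_core // mem_spider_path //; lia.
by apply: mem_spider_hair; [apply: leg_lt | lia].
Qed.

(** For a foot outside the core, the leg names a landmark and the level the depth of the foot; a
    landmark has only one ancestor at that depth, and [foot_inj] concludes. *)
Lemma loc_inj z z' : side z = side z' -> loc z = loc z' -> z = z'.
Proof.
move=> eq_s; rewrite /loc.
have [z0|] := eqVneq (depth z) 0; have [z'0|] := eqVneq (depth z') 0 => //.
  by move=> _; rewrite (depth_core z0) (depth_core z'0) eq_s.
rewrite -!lt0n => z'_gt0 z_gt0 [eq_leg /hair_inj[eq_lv eq_m]].
have lz := level_gt0 z_gt0; have lz' := level_gt0 z'_gt0.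
have lez := level_le z; have lez' := level_le z'.
apply: foot_inj; last by lia.
have [f0|f_gt0] := posnP (depth (foot z)); have [f'0|f'_gt0] := posnP (depth (foot z')).
- by rewrite (depth_core f0) (depth_core f'0) !foot_side eq_s.
- by have := leg_lt f'_gt0; rewrite -eq_leg (leg_core f0) eq_s ltnn.
- by have := leg_lt f_gt0; rewrite eq_leg (leg_core f'0) eq_s ltnn.
have := leg_ancestor f'_gt0; rewrite -eq_leg -eq_s.
move/(ancestor_inj e_sym e_irr e_tree (leg_ancestor f_gt0)); apply.
rewrite !height_depth !foot_side eq_s; move: eq_lv lz lz'; rewrite /level.
by rewrite !eqn0Ngt f_gt0 f'_gt0 /=; lia.
Qed.

Definition prefix_of b := if b then [:: (nb false).+1] else [::].
Definition addr z := prefix_of (side z) ++ loc z.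

(** By [head_spider] no address on the side of [u] begins with [(nb false).+1], so the prefix can be
    read off. *)
Lemma addr_split z b t : t \in spider r (nb b) ->
  addr z = prefix_of b ++ t -> side z = b /\ loc z = t.
Proof.
move=> /head_spider ht; have /head_spider := loc_spider z; rewrite /addr.
case: b ht; case: (side z) => //= ht hz; first by case.
  by move=> eq_t; rewrite eq_t ltnn in hz.
by move=> eq_t; rewrite -eq_t ltnn in ht.
Qed.

Lemma addr_inj : injective addr.
Proof.
by move=> z z' /(addr_split (loc_spider z'))[]; apply: loc_inj.
Qed.

Definition addrs :=
  if o then dispider r (nb false) (nb true) else spider r (nb false).

Lemma mem_addrs (b : bool) t : (b -> o) -> t \in spider r (nb b) ->
  prefix_of b ++ t \in addrs.
Proof.
rewrite /addrs; case: b => [/(_ isT) -> tS|_ tS]; rewrite /dispider.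
  by rewrite mem_cat map_f ?orbT.
by case: o; rewrite ?mem_cat tS.
Qed.

Lemma addr_addrs z : addr z \in addrs.
Proof. by apply: mem_addrs (loc_spider z) => /andP[]. Qed.

Lemma card_le_addrs : #|T| <= size addrs.
Proof.
rewrite cardE -(size_map addr); apply: uniq_leq_size.
  by rewrite (map_inj_uniq addr_inj) enum_uniq.
by move=> _ /mapP[z _ ->]; apply: addr_addrs.
Qed.

(** * The extremal case *)

Section Extremal.
Hypothesis T_max : size addrs <= #|T|.

Lemma loc_surj (b : bool) t : (b -> o) -> t \in spider r (nb b) ->
  exists2 z, side z = b & loc z = t.
Proof.
move=> bo tS; have uT : uniq (map addr (enum T)).
  by rewrite (map_inj_uniq addr_inj) enum_uniq.
have sub : {subset map addr (enum T) <= addrs}.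
  by move=> _ /mapP[z _ ->]; apply: addr_addrs.
have [|_ eq_s] := uniq_min_size uT sub; first by rewrite size_map -cardE.
have := mem_addrs bo tS; rewrite -eq_s => /mapP[z _ /esym/(addr_split tS)[sz lz]].
by exists z.
Qed.

Lemma parent_w : p w = u.
Proof.
apply/eqP; rewrite -(height_root e_tree) (height_parent e_sym e_irr e_tree).
by rewrite hw.
Qed.

(** On the trunk, [leg] might pick an earlier landmark for [p z] than for [z]. Surjectivity rules
    this out: the vertex [z'] with the shortened address has its foot above the same landmark, at
    the depth of [p z], so it is [p z]. *)
Lemma loc_parent z : 0 < depth z -> loc (p z) = take (size (loc z)).-1 (loc z).
Proof.
move=> z_gt0; rewrite /loc (gtn_eqF z_gt0) /= size_hair.
have [zA|zA] := boolP (z \in trunk); last first.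
  have -> : leg (p z) = leg z by rewrite /leg -foot_parent // side_parent.
  have := foot_depth (p z); rewrite /level -foot_parent // depth_parent.
  case: (depth (foot z)) z_gt0 => [|i]; case: (depth z) => // -[|n] //= _.
    by rewrite !subnn addn0 /= take_hair0.
  by rewrite !ltnS => le_i; rewrite subSS subSn // addnS /= take_hair.
have -> : level z = depth z by rewrite /level foot_id // if_same.
rewrite subnn addn0 depth_parent.
case Dz: (depth z) z_gt0 => [//|[//|n]] _; rewrite /= take_hair0.
have fz : foot z = z by rewrite foot_id.
have z_leg : leg z < nb (side z) by apply: leg_lt; rewrite fz Dz.
have [| |z' sz'] := @loc_surj (side z) (leg z :: hair n 0).
- by case/andP.
- by apply: mem_spider_hair => //; have := depth_le z; lia.
rewrite /loc; case: eqP => // /eqP; rewrite -lt0n => z'_gt0.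
case=> leg_z' /hair_inj[lev1 lev2].
have lev_gt0 := level_gt0 z'_gt0; have lev_le := level_le z'.
(* A foot in the core would give [z'] the leg [nb (side z)], which exceeds that of [z]. *)
have f_gt0 : 0 < depth (foot z').
  by rewrite lt0n; apply/eqP => /leg_core; rewrite leg_z' sz'; lia.
have Df : depth (foot z') = level z' by rewrite /level (gtn_eqF f_gt0).
have := leg_ancestor f_gt0; rewrite leg_z' sz'.
have : 0 < depth (foot z) by rewrite fz Dz.
move=> /leg_ancestor; rewrite fz => xz xz'.
have xpz := connect_trans xz (fconnect1 p z).
have eq_pz : foot z' = p z.
  apply: (ancestor_inj e_sym e_irr e_tree xz' xpz).
  by rewrite !height_depth foot_side sz' side_parent ?depth_parent ?Dz //; lia.
have <- : z' = p z.
  rewrite -eq_pz; apply: foot_inj; last by lia.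
  by rewrite [RHS]foot_id // foot_trunk.
have -> : level z' = n.+1 by lia.
by rewrite subnn leg_z'.
Qed.

Lemma addr_u : addr u = [::].
Proof. by rewrite /addr side_u /loc depth_u. Qed.

Lemma addr_parent z : z != u -> addr (p z) = take (size (addr z)).-1 (addr z).
Proof.
move=> zu; have [z0|z_gt0] := posnP (depth z).
  (* A vertex of depth 0 other than [u] is [w], whose address has one entry. *)
  have := depth_core z0; case sz: (side z) => /= Dz; last by rewrite Dz eqxx in zu.
  by rewrite {1}Dz parent_w addr_u /addr sz /loc z0.
have : loc z != [::] by rewrite /loc (gtn_eqF z_gt0).
by rewrite /addr side_parent // loc_parent //; case: (side z) => //=; case: (loc z).
Qed.

Lemma addr_adjE x y : addr_adj (addr x) (addr y) = e x y.
Proof.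
have addr0 z : (addr z == [::]) = (z == u) by rewrite -addr_u (inj_eq addr_inj).
rewrite (edge_parent e_sym e_irr e_tree u) /addr_adj !addr0 orbC.
have adj a b : (a != u) && (addr b == take (size (addr a)).-1 (addr a))
    = (a != u) && (p a == b).
  have [//|au] := eqVneq a u.
  by rewrite -addr_parent // (inj_eq addr_inj) eq_sym.
by rewrite !adj.
Qed.

(* Otherwise the first vertex of the landmark-free path at the end of the core
   edge nearer to R and the other end of that edge are not resolved. *)
Lemma nb_gt0 b : o -> 0 < r -> 0 < nb b.
Proof.
move=> o1 r_gt0; rewrite lt0n; apply/eqP => nb0.
have sideR x : x \in R -> side x = ~~ b.
  move=> xR; apply/eqP; apply: contraT => sx.
  have : x \in landmarks b by rewrite mem_enum inE xR; case: (side x) (b) sx => -[].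
  by rewrite (size0nil nb0).
have [//| |z sz] := @loc_surj (~~ b) (nb (~~ b) :: hair 0 0).
  by rewrite mem_spider_path.
rewrite /loc; case: eqP => // /eqP; rewrite -lt0n => z_gt0 [leg_z /hair_inj[lv1 lv2]].
have f0 : depth (foot z) = 0.
  by apply/eqP; rewrite eqn0Ngt; apply/negP => /leg_lt; rewrite leg_z sz ltnn.
have lv_gt0 := level_gt0 z_gt0; have lv_le := level_le z.
have fz : foot z = core (~~ b) by rewrite (depth_core f0) foot_side sz.
have e_conn := proj1 e_tree.
have wu : w != u by rewrite -(height_root e_tree) hw.
(* All landmarks are on the side of [core (~~ b)], so [z] and [core b] are both one step beyond
   it. *)
have Dz : z = core b.
  apply: resolving_eq => x xR; rewrite dist_foot // f0 subn0 fz.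
  have -> : depth z = 1 by lia.
  have := sideR x xR; rewrite /side o1 /core; case: (b) => /= xw.
    by rewrite (dist_parent e_sym e_irr e_tree wu (negbT xw)) parent_w addn1.
  have uw : ~~ fconnect p u w by apply/negP => /anc_h; rewrite hw /height dist0.
  have := cut_dist e_sym e_irr e_tree wu uw xw; rewrite parent_w dist0.
  have := dist_triangle e_conn w x u; have := dist_sym e_sym e_conn.
  by move=> dC; rewrite (dC x u) (dC x w) (dC w u); move: hw; rewrite /height; lia.
have : side (core b) = b.
  by rewrite /core; case: (b); rewrite ?side_u // /side o1 connect0.
by rewrite -Dz sz; case: (b).
Qed.

End Extremal.

End Addressing.

(** * From addresses to isomorphisms, and the theorem *)

Lemma isomorphic_addr_graph (T : finType) (e : rel T) S (f : T -> seq nat) :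
  uniq S -> injective f -> (forall z, f z \in S) -> size S <= #|T| ->
  (forall x y, addr_adj (f x) (f y) = e x y) -> isomorphic e (addr_graph S).
Proof.
move=> uS f_inj fS le_S f_adj; exists (fun z => SeqSub (fS z)); split=> //.
apply: inj_card_bij; last by rewrite card_seq_sub.
by move=> x y /(congr1 val)/f_inj.
Qed.

Lemma card_isomorphic (T : finType) (e : rel T) S :
  uniq S -> isomorphic e (addr_graph S) -> #|T| = size S.
Proof. by move=> uS [f [/bij_eq_card-> _]]; rewrite card_seq_sub. Qed.

(** All vertices but [x] form a resolving set: of two distinct vertices one is not [x], and it alone
    is at distance 0 from itself. *)
Lemma metric_dim_lt (T : finType) (e : rel T) k (x : T) :
  is_tree e -> metric_dim e k -> k < #|T|.
Proof.
move=> [e_conn _] [_ k_min]; have T_gt0 : 0 < #|T| by apply/card_gt0P; exists x.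
rewrite -(prednK T_gt0) ltnS -(cardsC1 x); apply: k_min.
have dne a b : a != b -> dist e a a != dist e a b.
  by apply: contra => /eqP; rewrite dist0 => /esym/(dist_eq0 e_conn) ->.
apply/forallP => a; apply/forallP => b; apply/implyP => ab.
apply/exists_inP; have [ax|ax] := eqVneq a x.
  by exists b; rewrite ?inE -?ax 1?eq_sym ?dne // eq_sym.
by exists a; rewrite ?inE ?dne.
Qed.

Theorem theorem1 (T : finType) (e : rel T) (d k : nat) :
  simple_graph e -> is_tree e ->
  diameter e = d -> metric_dim e k -> 2 <= k ->
  (if odd d then 8 * #|T| <= (k * d - k + 8) * (d + 1)
   else 8 * #|T| <= (k * d + 4) * (d + 2)) /\
  (~~ odd d ->
     (8 * #|T| = (k * d + 4) * (d + 2) <-> isomorphic e (HS_even d k))) /\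
  (odd d ->
     (8 * #|T| = (k * d - k + 8) * (d + 1) <->
      exists a : nat, 0 < a < k /\ isomorphic e (HS_odd d k a))).
Proof.
move=> [e_sym e_irr] e_tree diam_d k_dim k_ge2.
have [[R [R_res R_k]] _] := k_dim.
have d_gt0 : 0 < diameter e.
  have [x [y [_ _ xy]]] : exists x y, [/\ x \in R, y \in R & x != y].
    by apply/card_gt1P; rewrite R_k.
  apply: leq_trans (dist_le_diameter e x y); rewrite lt0n.
  by apply: contra xy => /eqP/(dist_eq0 (proj1 e_tree))/eqP.
have [u [w [hw far]]] := tree_center e_sym e_irr e_tree d_gt0.
rewrite diam_d in d_gt0 far; set r := d./2 in far.
(* For odd [d] a vertex below [w] may be at distance [r.+1] from [u], but [depth] subtracts 1
   there. *)
have depth_r z : depth e u w (odd d) z <= r.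
  have := far z; rewrite /depth /side /height.
  by have := odd_double_half d; case: (fconnect _ _ _); case: (odd d) => /=; lia.
pose n := nb e u w (odd d) R.
have n_k : n false + n true = k by rewrite -R_k nb_sum.
set S := addrs e u w (odd d) r R.
have T_le : #|T| <= size S := card_le_addrs e_sym e_irr e_tree hw depth_r R_res.
have extremal : size S <= #|T| -> isomorphic e (addr_graph S).
  move=> S_le.
  have f_inj := addr_inj e_sym e_irr e_tree hw depth_r R_res.
  have f_S := addr_addrs e_sym e_irr e_tree hw depth_r R_res.
  have f_adj := addr_adjE e_sym e_irr e_tree hw depth_r R_res S_le.
  apply: (isomorphic_addr_graph _ f_inj f_S S_le f_adj).
  by rewrite /S /addrs; case: ifP => _; rewrite ?uniq_dispider ?uniq_spider.
have d_r := odd_double_half d; rewrite -/r -mul2n in d_r.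
have [d_odd|d_even] := boolP (odd d).
  have dE : d = (2 * r).+1 by rewrite -d_r d_odd.
  have SE : S = dispider r (n false) (n true) by rewrite /S /addrs {1}d_odd.
  have sz m m' : m + m' = k ->
      8 * size (dispider r m m') = (k * d - k + 8) * (d + 1).
    by move=> <-; rewrite size_dispider_odd -dE.
  split; last split=> // _; first by rewrite -(sz _ _ n_k) -SE leq_mul2l.
  split=> [T_eq|[a [/andP[_ a_k] iso]]]; last first.
    by rewrite (card_isomorphic _ iso) HS_odd_addrsE ?uniq_dispider // sz // subnKC 1?ltnW.
  have S_le : size S <= #|T| by rewrite -(leq_pmul2l (isT : 0 < 8)) T_eq SE sz.
  (* If [d] is 1, equality leaves two vertices, and then [k < 2]. *)
  have r_gt0 : 0 < r.
    rewrite lt0n; apply/eqP => r0; have := metric_dim_lt u e_tree k_dim.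
    by move: T_eq; rewrite dE r0; nia.
  (* The copies of L_r at [u] correspond to the landmarks on its side; [nb_gt0] puts at least one on
     each side. *)
  exists (n false); split.
    have n_gt0 b : 0 < n b.
      exact: (nb_gt0 e_sym e_irr e_tree hw depth_r R_res).
    by have := n_gt0 false; have := n_gt0 true; lia.
  rewrite /HS_odd HS_odd_addrsE (_ : k - n false = n true); last by lia.
  by rewrite -/r -SE; apply: extremal.
have dE : d = 2 * r by rewrite -d_r (negbTE d_even).
have SE : S = spider r k.
  rewrite /S /addrs {1}(negbTE d_even) -n_k -/(n _).
  (* For even [d] there is a single side, which holds all landmarks. *)
  rewrite [n true](_ : _ = 0) ?addn0 // /n /nb -cardE; apply: eq_card0 => x.
  by rewrite !inE /side (negbTE d_even) andbF.
have sz : 8 * size (spider r k) = (k * d + 4) * (d + 2).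
  by rewrite size_spider_even -dE.
split; first by rewrite -sz -SE leq_mul2l.
split=> // _; split=> [T_eq|iso]; last first.
  by rewrite (card_isomorphic _ iso) HS_even_addrsE ?uniq_spider.
rewrite /HS_even HS_even_addrsE -/r -SE; apply: extremal.
by rewrite -(leq_pmul2l (isT : 0 < 8)) T_eq SE sz.
Qed.
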